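(* Let $\mathbf P=(P,\le,0,1)$ be a complemented poset of finite length and consider the following statements: (i) for all $x,y\in P$, $x\le y$ implies $y^+\le x^+$, (ii) for all $x,y\in P$, $x\le y$ implies $y^+\le_1x^+$, (iii) for all $x,y\in P$, $x\le y$ implies $y^+\le_2x^+$, (iv) $\big(\mathrm{Min}\,U(x,y)\big)^+\le_1\mathrm{Max}\,L(x^+,y^+)$ for all $x,y\in P$, (v) $\mathrm{Min}\,U(x^+,y^+)\le_2\big(\mathrm{Max}\,L(x,y)\big)^+$ for all $x,y\in P$. Then (i) implies (ii) and (iii). Moreover, (iv) implies (ii), and (v) implies (iii). If for all $x\in P$, $x^+$ has a greatest element $x_2$ then (i) implies (iv). If, finally, for all $x\in P$, $x^+$ has a smallest element $x_1$ then (i) implies (v).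
   Context: $(P,\le,0,1)$ is a bounded poset with $0\ne1$; $b$ is a complement of $a$ ($a\perp b$) if $a\vee b=1$ and $a\wedge b=0$; the poset is complemented if every element has at least one complement. For $A\subseteq P$, $A^+:=\{x\in P\mid x\perp y\text{ for all }y\in A\}$, and $x^+:=\{x\}^+$ is the set of all complements of $x$ (singletons are identified with their element). A poset is of finite length if it has no infinite chains. $\mathrm{Max}\,A$ and $\mathrm{Min}\,A$ denote the sets of maximal and minimal elements of $A$; $L(A)$ and $U(A)$ are the sets of lower and upper bounds of $A$, with $L(A,B):=L(A\cup B)$, $U(x,y):=U(\{x,y\})$ etc. For sets, $A\le B$ means $x\le y$ for all $x\in A$, $y\in B$; $A\le_1B$ means every $x\in A$ has some $y\in B$ with $x\le y$; $A\le_2B$ means every $y\in B$ has some $x\in A$ with $x\le y$. *)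

(* Defs.v *)
From mathcomp Require Import all_boot all_order.
From mathcomp Require Import boolp classical_sets cardinality.

Set Implicit Arguments.
Unset Strict Implicit.
Unset Printing Implicit Defensive.

Local Open Scope classical_set_scope.
Local Open Scope order_scope.

Section Posets.
Context {d : Order.disp_t} {P : porderType d}.
Implicit Types A B C : set P.

Definition Max A : set P := [set x | A x /\ forall y, A y -> x <= y -> y = x].
Definition Min A : set P := [set x | A x /\ forall y, A y -> y <= x -> y = x].

Definition is_greatest A x := A x /\ ubound A x.
Definition is_least A x := A x /\ lbound A x.

Definition set_le A B := forall x y, A x -> B y -> x <= y.
Definition set_le1 A B := forall x, A x -> exists2 y, B y & x <= y.
Definition set_le2 A B := forall y, B y -> exists2 x, A x & x <= y.

End Posets.

Definition finite_length {d : Order.disp_t} (P : porderType d) :=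
  forall C : set P, total_on C (fun x y => x <= y) -> finite_set C.

Section Complements.
Context {d : Order.disp_t} {P : tbPOrderType d}.

(* The join (meet) of two elements of a poset need not exist: part of the
   requirement is that [set x; y] has a supremum (infimum). *)
Definition is_complement (x y : P) :=
  supremums [set x; y] \top /\ infimums [set x; y] \bot.

Definition complements (A : set P) : set P :=
  [set x | forall y, A y -> is_complement x y].

End Complements.

Definition complemented {d : Order.disp_t} (P : tbPOrderType d) :=
  forall x : P, exists y, is_complement x y.

Section Conditions.
Context {d : Order.disp_t} (P : tbPOrderType d).

Definition condition_i := forall x y : P,
  x <= y -> set_le (complements [set y]) (complements [set x]).

Definition condition_ii := forall x y : P,
  x <= y -> set_le1 (complements [set y]) (complements [set x]).

Definition condition_iii := forall x y : P,
  x <= y -> set_le2 (complements [set y]) (complements [set x]).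

Definition condition_iv := forall x y : P,
  set_le1 (complements (Min (ubound [set x; y])))
          (Max (lbound (complements [set x] `|` complements [set y]))).

Definition condition_v := forall x y : P,
  set_le2 (Min (ubound (complements [set x] `|` complements [set y])))
          (complements (Max (lbound [set x; y]))).

End Conditions.

(* Main.v *)
Require Import Defs.
From mathcomp Require Import all_boot all_order.
From mathcomp Require Import boolp classical_sets cardinality.

Import Order.TTheory.

Local Open Scope classical_set_scope.
Local Open Scope order_scope.

(** In a poset of finite length every element of a set lies below a maximal and
above a minimal element of that set.  So, given [z] in [(Min U(x,y))^+], pick a
minimal [m] in [U(x,y)], which is nonempty as it contains [1]; then [z] is a
complement of [m] and (i) applied to [x <= m] and [y <= m] puts [z] below
[x^+] and [y^+], whence (iv) by going up to a maximal lower bound; (v) is dual.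
Conversely, for [x <= y] the sets [Min U(x,y)] and [Max L(x,y)] are [{y}] and
[{x}], so (iv) and (v) specialize to (ii) and (iii), as [x^+] and [y^+] are
nonempty. *)

(** By induction on an enumeration: totality compares the head with the greatest element of the
    tail, and the larger one wins. *)
Lemma finite_chain_greatest {d : Order.disp_t} {P : porderType d} (C : set P) x :
  finite_set C -> total_on C (fun y z => y <= z) -> C x ->
  exists m, is_greatest C m.
Proof.
move=> /finite_seqP[s ->]; elim: s x => [//|a s IHs] x tot _.
(* The induction hypothesis needs a nonempty tail, so the singleton is treated apart. *)
case: s => [|b s] in IHs tot *.
  by exists a; split=> [|y] /=; rewrite inE// => /eqP->.
have sub y : [set` b :: s] y -> [set` a :: b :: s] y.
  by move=> ys; apply/predU1P; right.
have [y z ys zs||m [ms mub]] := IHs b; [by apply: tot; exact: sub| |].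
  exact: mem_head.
have [am|ma] := tot a m (mem_head _ _) (sub m ms).
- by exists m; split=> [|y /predU1P[->|/mub]//]; exact: sub.
exists a; split=> [|y /predU1P[->//|/mub ym]]; first exact: mem_head.
exact: le_trans ym ma.
Qed.

Lemma finite_length_Max {d : Order.disp_t} {P : porderType d} (A : set P) x :
  finite_length P -> A x -> exists2 m, Max A m & x <= m.
Proof.
(* Zorn is applied to the part of [A] above [x], so that the maximal element found is above [x]. *)
move=> Pfin Ax; pose T := {z : P | A z /\ x <= z}.
have [|||C totC|[m [Am xm]] mmax] := @Zorn T (fun s t => sval s <= sval t).
- by move=> t; exact: lexx.
- by move=> r s t; exact: le_trans.
- by move=> s t st ts; apply: eq_sig_hprop => [z|];
    [exact: Prop_irrelevance|apply/le_anti; rewrite st ts].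
(* Adding [x], which lies below all of [T], keeps a chain and makes it nonempty, so that the empty
   chain is bounded too. *)
- pose C' : set P := x |` [set sval t | t in C].
  have totC' : total_on C' (fun y z => y <= z).
    move=> _ _ [->|[[y [Ay xy]] Cy <-]] [->|[[z [Az xz]] Cz <-]] //=.
    + by left.
    + by left.
    + by right.
    + exact: totC Cy Cz.
  have [m [C'm mub]] := finite_chain_greatest C' x (Pfin _ totC') totC' (or_introl erefl).
  have Tm : A m /\ x <= m.
    by case: C'm => [->|[[y yP] _ <-]].
  by exists (exist _ m Tm) => t Ct; apply: mub; right; exists t.
(* An element of [A] above [m] is above [x], hence in [T], so maximality in [T] gives maximality in
   [A]. *)
exists m => //; split=> // y Ay my.
by have /(_ my)/(congr1 sval) := mmax (exist _ y (conj Ay (le_trans xm my))).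
Qed.

Lemma finite_length_dual {d : Order.disp_t} (P : porderType d) :
  finite_length P -> finite_length P^d.
Proof. by move=> Pfin C totC; apply: Pfin => y z Cy Cz; apply/or_comm/totC. Qed.

(** [Min] in [P] is by conversion [Max] in the dual order. *)
Lemma finite_length_Min {d : Order.disp_t} {P : porderType d} (A : set P) x :
  finite_length P -> A x -> exists2 m, Min A m & m <= x.
Proof. by move=> /finite_length_dual; exact: finite_length_Max. Qed.

Section Complements.
Context {d : Order.disp_t} {P : tbPOrderType d}.
Implicit Types x y z : P.

Lemma is_complement_sym x y : is_complement x y -> is_complement y x.
Proof. by rewrite /is_complement setUC. Qed.

Lemma complements1 x y : complements [set x] y <-> is_complement y x.
Proof. by split=> [|yx _ ->//]; apply. Qed.

Lemma complemented_nonempty x : complemented P -> complements [set x] !=set0.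
Proof.
by case/(_ x) => y /is_complement_sym xy; exists y; apply/complements1.
Qed.

Lemma complements_mem (A : set P) x z :
  complements A z -> A x -> complements [set x] z.
Proof. by move=> Az Ax; apply/complements1/Az. Qed.

(** Here [y] is itself an upper bound and lies below all the others. *)
Lemma Min_ubound2 x y : x <= y -> Min (ubound [set x; y]) = [set y].
Proof.
move=> xy; have Uy : ubound [set x; y] y by move=> _ [->|->].
apply/seteqP; split=> [z [Uz zmin]|_ ->] /=.
  by rewrite (zmin y)//; apply: Uz; right.
split=> // z Uz zy; apply/le_anti; rewrite zy; apply: Uz.
by right.
Qed.

Lemma Max_lbound2 x y : x <= y -> Max (lbound [set x; y]) = [set x].
Proof.
move=> xy; have Lx : lbound [set x; y] x by move=> _ [->|->].
apply/seteqP; split=> [z [Lz zmax]|_ ->] /=.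
  by rewrite (zmax x)//; apply: Lz; left.
split=> // z Lz xz; apply/le_anti; rewrite xz andbT; apply: Lz.
by left.
Qed.

Lemma condition_i_ii : complemented P -> condition_i P -> condition_ii P.
Proof.
move=> /complemented_nonempty Pcompl Pi x y xy z yz.
by have [w xw] := Pcompl x; exists w => //; exact: Pi xy _ _ yz xw.
Qed.

Lemma condition_i_iii : complemented P -> condition_i P -> condition_iii P.
Proof.
move=> /complemented_nonempty Pcompl Pi x y xy z xz.
by have [w yw] := Pcompl y; exists w => //; exact: Pi xy _ _ yw xz.
Qed.

Lemma condition_iv_ii : complemented P -> condition_iv P -> condition_ii P.
Proof.
move=> /complemented_nonempty Pcompl Piv x y xy z yz.
have [w [Lw _] zw] : exists2 w,
    Max (lbound (complements [set x] `|` complements [set y])) w & z <= w.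
  by apply: Piv; rewrite Min_ubound2.
(* Any complement [v] of [x] will do, since [w] is a lower bound of all of them. *)
have [v xv] := Pcompl x; exists v => //.
by apply: le_trans zw _; apply: Lw; left.
Qed.

Lemma condition_v_iii : complemented P -> condition_v P -> condition_iii P.
Proof.
move=> /complemented_nonempty Pcompl Pv x y xy z xz.
have [w [Uw _] wz] : exists2 w,
    Min (ubound (complements [set x] `|` complements [set y])) w & w <= z.
  by apply: Pv; rewrite Max_lbound2.
have [v yv] := Pcompl y; exists v => //.
by apply: le_trans wz; apply: Uw; right.
Qed.

Lemma condition_i_iv : finite_length P -> condition_i P -> condition_iv P.
Proof.
(* It remains to show that [z] is itself a lower bound of both sets of complements. *)
move=> Pfin Pi x y z zMin; apply: finite_length_Max => //.
have [|m Um _] := finite_length_Min (ubound [set x; y]) \top Pfin.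
  by move=> u _; exact: lex1.
have zm := complements_mem _ _ _ zMin Um.
case: Um => Um _.
by move=> w [xw|yw]; [apply: (Pi x m)|apply: (Pi y m)] => //;
  apply: Um; [left|right].
Qed.

Lemma condition_i_v : finite_length P -> condition_i P -> condition_v P.
Proof.
move=> Pfin Pi x y z zMax; apply: finite_length_Min => //.
have [|m Lm _] := finite_length_Max (lbound [set x; y]) \bot Pfin.
  by move=> u _; exact: le0x.
have zm := complements_mem _ _ _ zMax Lm.
case: Lm => Lm _.
(* As [m] is below [x] and [y], (i) puts each of their complements [w] below the complement [z] of
   [m]. *)
by move=> w [xw|yw]; [apply: (Pi m x)|apply: (Pi m y)] => //;
  apply: Lm; [left|right].
Qed.

End Complements.

Theorem theorem3p7 (d : Order.disp_t) (P : tbPOrderType d)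
    (neq01 : (\bot : P) <> (\top : P))
    (Pcompl : complemented P) (Pfin : finite_length P) :
  [/\ (condition_i P -> condition_ii P /\ condition_iii P),
      (condition_iv P -> condition_ii P),
      (condition_v P -> condition_iii P),
      ((forall x : P, exists x2 : P, is_greatest (complements [set x]) x2) ->
        condition_i P -> condition_iv P)
    & ((forall x : P, exists x1 : P, is_least (complements [set x]) x1) ->
        condition_i P -> condition_v P)].
Proof.
split.
- by move=> Pi; split; [exact: condition_i_ii|exact: condition_i_iii].
- exact: condition_iv_ii.
- exact: condition_v_iii.
- by move=> _; exact: condition_i_iv.
- by move=> _; exact: condition_i_v.
Qed.
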